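(* Consider the uniform attachment graph process $G_{t,m}$. Fix an integer $r>1$, let $X(t)$ ($t\ge r$) be the number of descendants of vertex $r$ among $[t]$, and let $p(t):=X(t)/t$. (i) If $m=1$, then almost surely $\lim_{t\to\infty}p(t)$ exists and it has the same distribution as the minimum of $r-1$ independent uniform random variables on $[0,1]$. Consequently, almost surely $\liminf_{t\to\infty}p(t)>0$. (ii) If $m>1$, then almost surely $\lim_{t\to\infty}p(t)=1$.
   Context: Uniform attachment process $G_{t,m}$ (integer $m\ge1$): start with the single vertex $1$; for each $t\ge1$, vertex $t+1$ selects $m$ vertices from $[t]$ independently and uniformly at random (repetitions allowed) and is joined by an edge to each selected vertex. Descendants of a fixed vertex $r$: $r$ is a descendant of itself; a vertex $x>r$ is a descendant of $r$ iff at least one of the vertices selected by $x$ is a descendant of $r$. *)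

(* Defs.v *)
From HB Require Import structures.
From mathcomp Require Import all_boot all_order all_algebra.
From mathcomp Require Import finmap.
From mathcomp Require Import all_classical all_reals all_analysis.

Set Implicit Arguments.
Unset Strict Implicit.
Unset Printing Implicit Defensive.

Import Order.TTheory GRing.Theory Num.Theory.
Import numFieldNormedType.Exports.

Local Open Scope classical_set_scope.
Local Open Scope ring_scope.

Definition mutually_independent d (T : measurableType d) (R : realType)
    (P : probability T R) (I : choiceType) (D : set I)
    d' (T' : measurableType d') (X : I -> {RV P >-> T'}) : Prop :=
  forall (J : {fset I}) (A : I -> set T'),
    [set` J] `<=` D -> (forall i, measurable (A i)) ->
    P (\bigcap_(i in [set` J]) (X i @^-1` A i)) =
      (\prod_(i <- J) P (X i @^-1` A i))%E.

(* [S x j] is the [j]-th vertex selected by vertex [x] when it joins, for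
   [x >= 2]; the values [S 0 j] and [S 1 j] are irrelevant. *)
Definition uniform_attachment d (T : measurableType d) (R : realType)
    (P : probability T R) (m : nat)
    (S : nat -> 'I_m -> {RV P >-> nat}) : Prop :=
  mutually_independent [set i : nat * 'I_m | (1 < i.1)%N] (fun i => S i.1 i.2)
  /\ forall (x : nat) (j : 'I_m) (k : nat), (1 < x)%N ->
       P (S x j @^-1` [set k]) =
         (if (0 < k < x)%N then (x.-1)%:R^-1 else 0)%:E.

Inductive descendant (m : nat) (s : nat -> 'I_m -> nat) (r : nat) : nat -> Prop :=
| descendant_self : descendant s r r
| descendant_select (x : nat) (j : 'I_m) :
    (r < x)%N -> descendant s r (s x j) -> descendant s r x.

Definition num_descendants (m : nat) (s : nat -> 'I_m -> nat) (r t : nat) : nat :=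
  (\sum_(1 <= x < t.+1 | `[< descendant s r x >]) 1)%N.

Definition desc_ratio (R : realType) (m : nat) (s : nat -> 'I_m -> nat)
    (r t : nat) : R :=
  (num_descendants s r t)%:R / t%:R.

Definition iid_uniform01 d (T : measurableType d) (R : realType)
    (P : probability T R) (n : nat) (U : 'I_n -> {RV P >-> R}) : Prop :=
  mutually_independent setT U /\
  forall (i : 'I_n) (B : set R), measurable B ->
    distribution P (U i) B = uniform_prob (@ltr01 R) B.

(* The neutral element 1 is harmless: variables uniform on [0, 1] are almost
   surely at most 1. *)
Definition family_min (T : Type) (R : realType) (n : nat) (U : 'I_n -> T -> R)
    (w : T) : R :=
  \big[Num.min/1]_(i < n) U i w.

(* Statements quantifying over families satisfying [iid_uniform01] are not
   vacuous. *)
Lemma iid_uniform01_exists (R : realType) (n : nat) :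
  exists (d : measure_display) (T : measurableType d) (P : probability T R)
    (U : 'I_n -> {RV P >-> R}), iid_uniform01 U.
Proof.
suff [d [T [P [U HU]]]] : exists (d : measure_display) (T : measurableType d)
    (P : probability T R) (U : 'I_n -> {RV P >-> R}),
    forall A : 'I_n -> set R, (forall i, measurable (A i)) ->
    P (\bigcap_i (U i @^-1` A i)) =
      (\prod_(i < n) uniform_prob (@ltr01 R) (A i))%E.
  have U1 i (B : set R) : measurable B ->
      P (U i @^-1` B) = uniform_prob (@ltr01 R) B.
    move=> mB; have := HU (fun j => if j == i then B else setT).
    rewrite (bigD1 i)//= eqxx big1 ?mule1; last first.
      by move=> j /negPf ->; rewrite probability_setT.
    move=> <-; last by move=> j; case: ifP.
    congr (P _); apply/seteqP; split => w /=.
      by move=> wB j _; case: eqP => [->|].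
    by move=> /(_ i I); rewrite eqxx.
  exists d, T, P, U; split; last by move=> i B mB; exact: U1.
  move=> J A _ mA.
  have := HU (fun j => if j \in J then A j else setT).
  rewrite (bigID (mem J))/= [X in (_ * X)%E]big1 ?mule1; last first.
    by move=> j /negPf ->; rewrite probability_setT.
  move=> HJ; transitivity (\prod_(i < n | i \in J) uniform_prob (@ltr01 R) (A i))%E.
    rewrite (eq_bigr (fun i => uniform_prob (@ltr01 R) (if i \in J then A i else setT))); last by move=> i ->.
    rewrite -HJ; last by move=> j; case: ifP.
    congr (P _); apply/seteqP; split => w /= wA j.
      by move=> _; case: ifPn => // jJ; exact: wA.
    by move=> jJ; have := wA j I; rewrite jJ.
  rewrite -[LHS]big_filter [RHS](eq_bigr (fun i => uniform_prob (@ltr01 R) (A i))); last first.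
    by move=> i _; exact: U1.
  apply: perm_big; apply: uniq_perm; rewrite ?filter_uniq ?index_enum_uniq ?fset_uniq//.
  by move=> i; rewrite mem_filter mem_index_enum andbT.
elim: n => [|n [d [T [P [U HU]]]]].
  pose mu : probability (measurableTypeR R) R := uniform_prob (@ltr01 R).
  exists _, _, mu, (fun=> cst 0 : {mfun _ >-> R}) => A _.
  rewrite big_ord0 (_ : \bigcap_i _ = setT) ?probability_setT//.
  by apply/seteqP; split => // w _ [].
pose mu : probability (measurableTypeR R) R := uniform_prob (@ltr01 R).
pose Q : probability (T * measurableTypeR R)%type R := (P \x mu)%E.
pose V (i : 'I_n.+1) : T * measurableTypeR R -> R :=
  if unlift ord_max i is Some j then U j \o fst else snd.
have mV i : measurable_fun setT (V i).
  rewrite /V; case: unliftP => [j _|_]; last exact: measurable_snd.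
  by apply: measurableT_comp; [exact: measurable_funPT|exact: measurable_fst].
pose W i : {RV Q >-> R} := HB.pack_for {mfun _ >-> R} (V i)
  (@isMeasurableFun.Build _ _ _ _ (V i) (mV i)).
exists _, _, Q, W => A mA.
rewrite big_ord_recr/= -HU//.
rewrite (_ : \bigcap_i _ = (\bigcap_i (U i @^-1` A (widen_ord (leqnSn n) i))) `*` A ord_max).
  rewrite [LHS]product_measure1E//; last exact: mA.
  by apply: fin_bigcap_measurable => // i _; rewrite -[X in measurable X]setTI; exact: measurable_funPT.
have liftE (i : 'I_n) : lift ord_max i = widen_ord (leqnSn n) i.
  by apply: val_inj; rewrite /= /bump leqNgt ltn_ord.
apply/seteqP; split => -[w x] /=.
  move=> H; split.
    move=> i _; have := H (lift ord_max i) I.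
    by rewrite /W /V /= liftK liftE.
  by have := H ord_max I; rewrite /W /V /= unlift_none.
move=> [H1 H2] i _; rewrite /W /V /=.
by case: unliftP => [j ->|->]//=; rewrite liftE; exact: H1.
Qed.

(* Main.v *)
(* Record the growth of the set of descendants of [r] as a history of bits. Given
   the history up to time [t], the next vertex is a descendant with probability
   [1 - (1 - p)^m], where [p] is the current proportion; hence
   [p(t) = p(r) + M(t) + A(t)] with [M] a martingale whose increments are
   [O(1/t)] and [A] nondecreasing. Kolmogorov's maximal inequality makes [M]
   converge almost surely, so [A] is bounded and [p] converges.

   For [m = 1] an induction on [t] gives the Polya urn formula
   [P(X(t) > k) = (t-1-k)_(r-1) / (t-1)_(r-1)] (falling factorials), whence
   [P(lim p > x) = (1-x)^(r-1)], the tail of the minimum of [r-1] uniforms.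

   For [m > 1] the drift of [A] is [(q - q^m)/(t+1)] with [q = 1 - p], so
   divergence of the harmonic series forces [lim p] to be 0 or 1; and the limit
   is positive since keeping only the first selection of each vertex embeds the
   process with [m = 1]. *)
Require Import Defs.
From HB Require Import structures.
From mathcomp Require Import all_boot all_order all_algebra.
From mathcomp Require Import finmap.
From mathcomp Require Import all_classical all_reals all_analysis.
From mathcomp Require Import ring lra zify.

Set Implicit Arguments.
Unset Strict Implicit.
Unset Printing Implicit Defensive.

Import Order.TTheory GRing.Theory Num.Theory.
Import numFieldNormedType.Exports.

Local Open Scope classical_set_scope.
Local Open Scope ring_scope.

(** Both sides are [a.+1 ^_ s.+1], peeled at its last or at its first factor; both vanish when
    [s > a.+1]. *)
Lemma ffact_succ_mul (R : numDomainType) a s :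
  (a.+1 ^_ s)%:R * (a.+1%:R - s%:R) = a.+1%:R * (a ^_ s)%:R :> R.
Proof.
have [sa|sa] := leqP s a.+1; last by rewrite !ffact_small ?mul0r ?mulr0//; lia.
by rewrite -natrB// -!natrM -ffactnSr ffactSS.
Qed.

(** * The Markov chain of histories *)

Section history_chain.
Variables (R : realType) (r K : nat).
Hypothesis r_gt0 : (0 < r)%N.
Implicit Types (h : seq bool) (b : bool) (g : seq bool -> R) (n k : nat).

(** The successor counts [r] itself, since [h] records only the vertices after [r]. *)
Definition ndesc h : nat := (count id h).+1.

Definition desc_prop h : R := (ndesc h)%:R / (r + size h)%:R.

Definition hitp h : R := 1 - (1 - desc_prop h) ^+ K.

(** The mean of [g] after [n] steps of the chain from [h], as a finite recursion; for indicators,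
    [P_rhist] identifies it with a probability of the process. *)
Fixpoint expect h n g : R :=
  if n is n'.+1 then
    hitp h * expect (true :: h) n' g + (1 - hitp h) * expect (false :: h) n' g
  else g h.

Definition step g h : R :=
  hitp h * g (true :: h) + (1 - hitp h) * g (false :: h).

Lemma size_gt0 h : 0 < (r + size h)%:R :> R.
Proof. by rewrite ltr0n addn_gt0 r_gt0. Qed.

Lemma prop_ge0 h : 0 <= desc_prop h.
Proof. by rewrite divr_ge0// ler0n. Qed.

Lemma prop_le1 h : desc_prop h <= 1.
Proof.
rewrite ler_pdivrMr ?size_gt0// mul1r ler_nat /ndesc.
by rewrite -add1n leq_add// count_size.
Qed.

Lemma hitp_ge0 h : 0 <= hitp h.
Proof.
have := prop_le1 h; have := prop_ge0 h; rewrite /hitp => p0 p1.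
by rewrite subr_ge0 exprn_ile1//; lra.
Qed.

Lemma hitp_le1 h : hitp h <= 1.
Proof.
have := prop_le1 h; rewrite /hitp => p1.
by rewrite gerDl oppr_le0 exprn_ge0// subr_ge0.
Qed.

(** The recursion of [expect] splits off the first step; inductions on time need the last one split
    off instead. *)
Lemma expectSr h n g : expect h n.+1 g = expect h n (step g).
Proof.
elim: n h => [//|n IH] h.
rewrite -[LHS]/(hitp h * expect (true :: h) n.+1 g +
  (1 - hitp h) * expect (false :: h) n.+1 g).
by rewrite !IH.
Qed.

Lemma eq_expect h n g1 g2 :
  (forall h', size h' = (size h + n)%N -> g1 h' = g2 h') ->
  expect h n g1 = expect h n g2.
Proof.
elim: n h => [|n IH] h eg /=; first by rewrite eg ?addn0.
by rewrite !IH// => h'; rewrite /= addSnnS; exact: eg.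
Qed.

Lemma le_expect h n g1 g2 :
  (forall h', size h' = (size h + n)%N -> g1 h' <= g2 h') ->
  expect h n g1 <= expect h n g2.
Proof.
elim: n h => [|n IH] h leg /=; first by rewrite leg ?addn0.
have p1 := hitp_le1 h; have p0 := hitp_ge0 h.
have p1' : 0 <= 1 - hitp h by rewrite subr_ge0.
by apply: lerD; apply: ler_wpM2l => //; apply: IH => h';
  rewrite /= addSnnS; exact: leg.
Qed.

Lemma expectD h n g1 g2 :
  expect h n (fun h' => g1 h' + g2 h') = expect h n g1 + expect h n g2.
Proof. by elim: n h => [//|n IH] h /=; rewrite !IH; ring. Qed.

Lemma expectZ h n c g : expect h n (fun h' => c * g h') = c * expect h n g.
Proof. by elim: n h => [//|n IH] h /=; rewrite !IH; ring. Qed.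

Lemma expect_cst h n c : expect h n (fun=> c) = c.
Proof. by elim: n h => [//|n IH] h /=; rewrite !IH; ring. Qed.

(** * The martingale part and its maximal inequality *)

Definition incr b h : R := (b%:R - hitp h) / (r + size h).+1%:R.

(** Accumulates only the centred part of the changes of [desc_prop]; the remainder goes into
    [drift]. *)
Fixpoint martingale h : R :=
  if h is b :: h' then martingale h' + incr b h' else 0.

(* Freezing the martingale at level [a] turns Chebyshev's inequality into
   Kolmogorov's maximal inequality. *)
Fixpoint stopped k (a : R) h : R :=
  if h is b :: h' then
    let v := stopped k a h' in
    if (size h' < k)%N || (a <= `|v|) then v else v + incr b h'
  else 0.

(** The increment is centred, so the cross term vanishes and only the variance
    [p * (1 - p) * T ^- 2] is added; nothing is added before time [k] or after freezing. *)
Lemma step_stopped2 k a h :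
  step (fun h' => stopped k a h' ^+ 2) h <=
    stopped k a h ^+ 2 +
    (if (size h < k)%N then 0 else (r + size h).+1%:R ^- 2).
Proof.
rewrite /step /=; set v := stopped k a h; rewrite /incr.
have := hitp_ge0 h; have := hitp_le1 h; set p := hitp h => p1 p0.
have [hk|hk] /= := boolP (size h < k)%N; first by nra.
set T := (r + size h).+1%:R : R.
have T2 : 0 <= T ^- 2 by rewrite invr_ge0 exprn_ge0// ler0n.
case: ifPn => _.
  by apply: (@le_trans _ _ (v ^+ 2)); [lra|rewrite lerDl].
have -> : p * (v + (true%:R - p) / T) ^+ 2 +
    (1 - p) * (v + (false%:R - p) / T) ^+ 2 = v ^+ 2 + p * (1 - p) * T ^- 2.
  by rewrite -exprVn mulr1n mulr0n; ring.
by rewrite lerD2l ler_piMl//; nra.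
Qed.

(** The one-step bounds telescope, as [(t + 1) ^- 2 <= t^-1 - (t + 1)^-1]; nothing accrues before
    time [k], hence [maxn k n]. *)
Lemma expect_stopped2 k a n :
  expect [::] n (fun h => stopped k a h ^+ 2) <=
    (r + k)%:R^-1 - (r + maxn k n)%:R^-1.
Proof.
elim: n => [|n IH]; first by rewrite /= maxn0 subrr expr0n.
rewrite expectSr; apply: le_trans.
  by apply: le_expect => h _; exact: step_stopped2.
rewrite expectD; set e := expect [::] n _ in IH *.
rewrite (@eq_expect _ _ _
  (fun=> if (n < k)%N then 0 else (r + n).+1%:R ^- 2)); last first.
  by move=> h /= ->.
rewrite expect_cst; case: ltnP => nk.
  rewrite addr0; move: IH; rewrite (maxn_idPl _)//; last exact: ltnW.
  by rewrite (maxn_idPl nk).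
rewrite (maxn_idPr _); last exact: leq_trans nk _.
move: IH; rewrite (maxn_idPr nk) => IH.
have t0 : 0 < (r + n)%:R :> R by rewrite ltr0n addn_gt0 r_gt0.
suff le_n : (r + n).+1%:R ^- 2 <= (r + n)%:R^-1 - (r + n.+1)%:R^-1 :> R.
  by apply: le_trans (lerD IH le_n) _; rewrite addrA subrK.
rewrite addnS -natr1; move: t0; set t := (r + n)%:R : R => t0.
have -> : t^-1 - (t + 1)^-1 = (t * (t + 1))^-1 by field; lra.
by rewrite lef_pV2 ?posrE; nra.
Qed.

(** Chebyshev's inequality. The bound is uniform in [n], so it will pass to the increasing union
    over all [n]. *)
Lemma stopped_tail k (a : R) n : 0 < a ->
  expect [::] n (fun h => (a <= `|stopped k a h|)%R%:R) <=
    a ^- 2 * (r + k)%:R^-1.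
Proof.
move=> a0.
apply: (@le_trans _ _ (expect [::] n (fun h => a ^- 2 * stopped k a h ^+ 2))).
  apply: le_expect => h _; set v := stopped _ _ _.
  have [av|_] /= := boolP (a <= `|v|); last first.
    by rewrite mulr_ge0// ?sqr_ge0// invr_ge0 exprn_ge0// ltW.
  rewrite mulrC ler_pdivlMr ?exprn_gt0// mul1r -[v ^+ 2]real_normK ?num_real//.
  by rewrite ler_sqr// nnegrE ltW.
rewrite expectZ; apply: ler_wpM2l; first by rewrite invr_ge0 exprn_ge0// ltW.
apply: le_trans (expect_stopped2 _ _ _) _.
by rewrite gerDl oppr_le0 invr_ge0 ler0n.
Qed.

(** * Pathwise convergence along a fixed sequence of bits *)

Section path.
Variables (b : nat -> bool) (h : nat -> seq bool).
Hypotheses (h0 : h 0%N = [::]) (hS : forall n, h n.+1 = b n :: h n).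

Lemma size_path n : size (h n) = n.
Proof. by elim: n => [|n IH]; rewrite ?h0// hS /= IH. Qed.

Lemma stopped_before k a n : (n <= k)%N -> stopped k a (h n) = 0.
Proof.
elim: n => [|n IH] nk; first by rewrite h0.
by rewrite hS /= size_path nk /= IH// ltnW.
Qed.

Lemma stopped_pathE k (a : R) n :
  (forall i, `|stopped k a (h i)| < a) -> (k <= n)%N ->
  stopped k a (h n) = martingale (h n) - martingale (h k).
Proof.
move=> lta; elim: n => [|n IH].
  by rewrite leqn0 => /eqP ->; rewrite h0 subrr.
rewrite leq_eqVlt => /orP[/eqP <-|]; first by rewrite stopped_before// subrr.
rewrite ltnS => kn; rewrite hS /= size_path ltnNge kn /= leNgt lta /= IH//.
by rewrite addrAC.
Qed.

(** A frozen value is kept, so the events of reaching the level increase with [n]; continuity from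
    below then applies to their union. *)
Lemma stopped_le k (a : R) n1 n2 : (n1 <= n2)%N ->
  a <= `|stopped k a (h n1)| -> a <= `|stopped k a (h n2)|.
Proof.
move=> le12 av; elim: n2 le12 => [|n IH]; first by rewrite leqn0 => /eqP <-.
rewrite leq_eqVlt => /orP[/eqP <-//|]; rewrite ltnS => /IH {}IH.
by rewrite hS /= IH orbT.
Qed.

(** Cauchy's criterion: a level never reached after time [k] keeps the martingale within that
    distance of its value at [k]. *)
Lemma mart_cvg :
  (forall j, exists k, forall i,
    `|stopped k (j.+1%:R^-1) (h i)| < j.+1%:R^-1) ->
  cvgn (martingale \o h).
Proof.
move=> H; apply: cauchy_cvg; apply: cauchy_exP => e e0.
have [k Hk] := H (Num.truncn e^-1); exists (martingale (h k)).
exists k => // n /= kn; rewrite -ball_normE /ball_ /= distrC.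
rewrite -(stopped_pathE Hk kn).
apply: lt_trans (Hk n) _.
by rewrite invf_plt ?posrE ?ltr0Sn// truncnS_gt.
Qed.

Fixpoint drift h : R :=
  if h is _ :: h' then drift h' + (hitp h' - desc_prop h') / (r + size h').+1%:R
  else 0.

Lemma prop_cons c h' :
  desc_prop (c :: h') =
  desc_prop h' + (c%:R - desc_prop h') / (r + size h').+1%:R.
Proof.
have t0 := size_gt0 h'.
rewrite /desc_prop /ndesc /= addnS -!natr1 natrD; move: t0.
set t := (r + size h')%:R => t0.
by field; lra.
Qed.

(** The Doob decomposition; [r^-1] is the proportion at time [r], when [r] is its only
    descendant. *)
Lemma propE h' : desc_prop h' = r%:R^-1 + martingale h' + drift h'.
Proof.
elim: h' => [|c h' IH] /=.
  by rewrite /desc_prop /ndesc /= addn0 !addr0 mul1r.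
by rewrite prop_cons {1}IH /incr; ring.
Qed.

Hypothesis K_gt0 : (0 < K)%N.

Lemma prop_le_hitp h' : desc_prop h' <= hitp h'.
Proof.
have := prop_le1 h'; have := prop_ge0 h'; rewrite /hitp => p0 p1.
suff : (1 - desc_prop h') ^+ K <= 1 - desc_prop h' by move=> ?; lra.
by rewrite -[leRHS]expr1 ler_wiXn2l//; lra.
Qed.

Lemma drift_nondecreasing : nondecreasing_seq (drift \o h).
Proof.
apply/nondecreasing_seqP => n /=.
rewrite hS /= lerDl divr_ge0 ?ler0n//.
by rewrite subr_ge0 prop_le_hitp.
Qed.

Lemma drift_cvg : cvgn (martingale \o h) -> cvgn (drift \o h).
Proof.
move=> /cvg_seq_bounded [B [_ HB]].
apply: nondecreasing_is_cvgn; first exact: drift_nondecreasing.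
(* By [propE] and [desc_prop <= 1], the drift is at most [1] plus the absolute value of the
   martingale, which every real strictly above [B] bounds. *)
exists (1 + (B + 1)) => _ [n _ <-] /=.
have := HB (B + 1); rewrite ltrDl ltr01 => /(_ isT n I) /=.
have := propE (h n); have := prop_le1 (h n).
have : 0 <= r%:R^-1 :> R by rewrite invr_ge0.
by rewrite ler_norml; lra.
Qed.

Lemma prop_cvg : cvgn (martingale \o h) -> cvgn (desc_prop \o h).
Proof.
move=> mc; have dc := drift_cvg mc.
rewrite (_ : desc_prop \o h =
  (fun n => r%:R^-1 + (martingale \o h) n + (drift \o h) n)).
  by apply: is_cvgD => //; apply: is_cvgD => //; exact: is_cvg_cst.
by apply/funext => n /=; rewrite propE.
Qed.

(* The total drift is finite while the harmonic series diverges, so the limit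
   is a zero of the drift [q - q ^+ K], where [q = 1 - desc_prop]. *)
Lemma prop_lim_eq1 (l : R) : (1 < K)%N -> cvgn (martingale \o h) ->
  desc_prop \o h @ \oo --> l -> 0 < l -> l = 1.
Proof.
move=> K1 mc pl l0.
have l1 : l <= 1.
  by apply: (cvgr_to_le pl); apply: nearW => n; exact: prop_le1.
apply/eqP; rewrite eq_le l1 /= leNgt; apply/negP => ll1.
(* [phi (desc_prop h)] is [hitp h - desc_prop h], the numerator of the drift increment; it is
   positive strictly between 0 and 1. *)
pose phi (p : R) := 1 - (1 - p) ^+ K - p.
have phil : phi (desc_prop (h n)) @[n --> \oo] --> phi l.
  have ql0 : 1 - desc_prop (h n) @[n --> \oo] --> 1 - l.
    by apply: cvgB; [exact: cvg_cst|exact: pl].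
  have ql : (1 - desc_prop (h n)) ^+ K @[n --> \oo] --> (1 - l) ^+ K.
    exact: (cvg_comp _ _ ql0 (@exprn_continuous R K (1 - l))).
  by apply: cvgB; [apply: cvgB; [exact: cvg_cst|exact: ql]|exact: pl].
have phil0 : 0 < phi l.
  rewrite /phi; suff : (1 - l) ^+ K < 1 - l by move=> ?; lra.
  by rewrite -[ltRHS]expr1 ltr_iXn2l//; lra.
have [N _ HN] : \forall n \near \oo, phi l / 2 < phi (desc_prop (h n)).
  by apply: (cvgr_gt (phi l)) => //; lra.
have [D [_ HD]] := cvg_seq_bounded (drift_cvg mc).
(* The comparison with the harmonic series rests on [r + N + n + 1 <= (r + N + 1) * (n + 1)]. *)
have driftN n : drift (h N) + phi l / 2 / (r + N).+1%:R * series harmonic n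
    <= drift (h (N + n)%N).
  elim: n => [|n IH]; first by rewrite /series /= big_geq// mulr0 addr0 addn0.
  rewrite seriesSr addnS hS /= size_path mulrDr addrA; apply: lerD => //.
  have := HN (N + n)%N (leq_addr _ _); rewrite /= -/(hitp _) => phiN.
  rewrite -mulrA -invfM; apply: ler_pM.
  - by lra.
  - by rewrite invr_ge0 mulr_ge0// ler0n.
  - exact: ltW.
  - by rewrite lef_pV2 ?posrE ?ltr0n// -?natrM ?ltr0n ?ler_nat//; nia.
apply: (@dvg_harmonic R).
apply: nondecreasing_is_cvgn.
  apply/nondecreasing_seqP => n; rewrite seriesSr lerDl.
  by rewrite invr_ge0 ler0n.
exists ((D + 1 - drift (h N)) / (phi l / 2 / (r + N).+1%:R)) => _ [n _ <-].
rewrite ler_pdivlMr ?divr_gt0// mulrC lerBrDl.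
apply: le_trans (driftN n) _; apply: le_trans (ler_norm _) _.
by apply: (HD (D + 1)) => //; rewrite ltrDl.
Qed.

End path.

(** * The urn formula for one selection *)

Lemma expect_tail n k : K = 1%N -> (1 < r)%N ->
  expect [::] n (fun h => (k < ndesc h)%:R) =
  (((r + n).-1 - k) ^_ r.-1)%:R / ((r + n).-1 ^_ r.-1)%:R.
Proof.
move=> K1 r1.
have ff0 t : (r <= t)%N -> (t.-1 ^_ r.-1)%:R != 0 :> R.
  by move=> rt; rewrite pnatr_eq0 -lt0n ffact_gt0; lia.
elim: n k => [|n IH] k.
  rewrite /= /ndesc /= addn0; case: k => [|k]; first by rewrite subn0 divff// ff0.
  by rewrite ffact_small ?mul0r//; lia.
case: k => [|k].
  rewrite subn0 divff ?ff0//; last by lia.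
  by rewrite (@eq_expect _ _ _ (fun=> 1)) ?expect_cst.
set t := (r + n)%N in IH *.
(* The count exceeds [k.+1] after the step if it did so before, or if it equals [k.+1] and the new
   vertex hits, with probability [k.+1 / t]. This mixes the tails at [k.+1] and at [k]. *)
rewrite expectSr (@eq_expect _ _ _ (fun h =>
    (1 - k.+1%:R / t%:R) * (k.+1 < ndesc h)%:R +
    (k.+1%:R / t%:R) * (k < ndesc h)%:R)); last first.
  move=> h /= hn; rewrite /step.
  have -> : hitp h = (ndesc h)%:R / t%:R.
    by rewrite /hitp K1 expr1 subKr /desc_prop hn.
  rewrite /ndesc /= add1n add0n.
  set c := count id h; rewrite !ltnS.
  have [kc|ck|->] := ltngtP k c; rewrite /= ?mulr0n ?mulr1n.
  - by lra.
  - by lra.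
  - by lra.
rewrite expectD !expectZ !IH addnS -/t /=.
have := ltn_predK r1; set s := r.-1 => sr.
have st : (s < t)%N by rewrite /t; lia.
have ft0 : (t ^_ s)%:R != 0 :> R by have := ff0 t.+1; apply; rewrite /t; lia.
have t0 : t%:R != 0 :> R by rewrite pnatr_eq0 -lt0n /t; lia.
have ts0 : (t%:R - s%:R) != 0 :> R by rewrite subr_eq0 eqr_nat gtn_eqF.
have f_t : (t.-1 ^_ s)%:R = (t ^_ s)%:R * (t%:R - s%:R) / t%:R :> R.
  have := ffact_succ_mul R t.-1 s; rewrite prednK; last by rewrite /t; lia.
  by move=> ->; rewrite mulrAC divff// mul1r.
(* In the first case all numerators are [0 ^_ s], which vanish since [s > 0]. *)
have [tk|kt] := leqP t k.+1.
  have -> : (t - k.+1 = 0)%N by lia.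
  have -> : (t.-1 - k.+1 = 0)%N by lia.
  have -> : (t.-1 - k = 0)%N by lia.
  by rewrite ffact0n (_ : (s == 0)%N = false) ?mul0r ?mulr0 ?addr0//; lia.
have -> : (t.-1 - k = t - k.+1)%N by lia.
have [a ta] : exists a, (t - k.+1 = a.+1)%N by exists (t - k.+2)%N; lia.
have -> : (t.-1 - k.+1 = a)%N by lia.
rewrite ta f_t.
(* As [t = (a + 1) + (k + 1)], the product [(a.+1 ^_ s) * (t - s)] splits into
   [(a.+1 ^_ s) * (a + 1 - s)], given by [ffact_succ_mul], and [(k + 1) * (a.+1 ^_ s)]. *)
have tE : t%:R = a%:R + k%:R + 2 :> R.
  by rewrite -!natrD; congr (_%:R); lia.
have := ffact_succ_mul R a s; rewrite -!natr1 => aE.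
rewrite -[RHS](mulfK ts0) -[RHS](mulfK t0).
have -> : (1 - (k%:R + 1) / t%:R) = (a%:R + 1) / t%:R :> R.
  by rewrite tE; field; rewrite -tE.
have -> : (a.+1 ^_ s)%:R / (t ^_ s)%:R * (t%:R - s%:R) =
    ((a%:R + 1) * (a ^_ s)%:R + (k%:R + 1) * (a.+1 ^_ s)%:R) / (t ^_ s)%:R :> R.
  by rewrite -aE tE; field.
by field; rewrite t0 ts0 ft0.
Qed.
End history_chain.

(** * Descendant lists encoded by histories *)

Section selection_path.
Variables (m r : nat).
Implicit Types (J : {set 'I_m}) (s : nat -> 'I_m -> nat) (h : seq bool).

(* A history [h] lists, most recent vertex first, whether each of the vertices
   [r + 1], ..., [r + size h] is a descendant of [r]. *)
Fixpoint desc_list h : seq nat :=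
  if h is b :: h' then
    if b then (r + size h').+1 :: desc_list h' else desc_list h'
  else [:: r].

Definition hit J (s : 'I_m -> nat) (D : seq nat) : bool :=
  [exists j in J, s j \in D].

(* Only the selections with index in [J] are taken into account, so that the
   process with one selection is coupled to the one with [m] selections. *)
Fixpoint hist J s n : seq bool :=
  if n is n'.+1 then
    hit J (s (r + n').+1) (desc_list (hist J s n')) :: hist J s n'
  else [::].

Lemma size_dec h : size (desc_list h) = ndesc h.
Proof. by elim: h => [|[] h IH] //=; rewrite IH. Qed.

Lemma dec_bounds h x : x \in desc_list h -> (r <= x <= r + size h)%N.
Proof.
elim: h => [|b h IH] /=; first by rewrite inE => /eqP ->; rewrite addn0 leqnn.
have {}IH : x \in desc_list h -> (r <= x <= r + (size h).+1)%N.
  by move=> /IH /andP[-> xr]; rewrite addnS leqW.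
by case: b => //; rewrite inE => /orP[/eqP ->|//]; lia.
Qed.

Lemma dec_uniq h : uniq (desc_list h).
Proof.
elim: h => [//|[] h IH] //=; rewrite IH andbT.
by apply/negP => /dec_bounds; rewrite ltnn andbF.
Qed.

Lemma r_in_dec h : r \in desc_list h.
Proof. by elim: h => [|[] h IH] /=; rewrite ?inE ?IH ?orbT. Qed.

Lemma size_hist J s n : size (hist J s n) = n.
Proof. by elim: n => [//|n IH] /=; rewrite IH. Qed.

Lemma sub_dec_cons b h : {subset desc_list h <= desc_list (b :: h)}.
Proof. by case: b => x //= xh; rewrite inE xh orbT. Qed.

Lemma sub_dec_hist J s n1 n2 : (n1 <= n2)%N ->
  {subset desc_list (hist J s n1) <= desc_list (hist J s n2)}.
Proof.
elim: n2 => [|n IH]; first by rewrite leqn0 => /eqP ->.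
rewrite leq_eqVlt => /orP[/eqP ->//|]; rewrite ltnS => /IH {}IH x /IH.
exact: sub_dec_cons.
Qed.

(** The coupling: an index of [J1] whose selection hits the smaller list also lies in [J2] and hits
    the larger list. *)
Lemma hist_subset J1 J2 s n : J1 \subset J2 ->
  {subset desc_list (hist J1 s n) <= desc_list (hist J2 s n)}.
Proof.
move=> J12; elim: n => [//|n IH] x.
have [->|xn] := eqVneq x (r + n).+1.
  rewrite /= !size_hist; case: ifPn => [/existsP[j /andP[j1 sj]] _|_].
    rewrite ifT ?inE ?eqxx//; apply/existsP; exists j.
    by rewrite (fintype.subsetP J12)//= IH.
  by move=> /dec_bounds; rewrite size_hist ltnn andbF.
move=> x1; apply: sub_dec_cons; apply: IH; move: x1 => /=.
by case: ifP => // _; rewrite inE size_hist (negPf xn).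
Qed.

Lemma ndesc_hist_le J1 J2 s n : J1 \subset J2 ->
  (ndesc (hist J1 s n) <= ndesc (hist J2 s n))%N.
Proof.
move=> J12; rewrite -!size_dec; apply: uniq_leq_size; first exact: dec_uniq.
exact: hist_subset.
Qed.

(** Induction on the derivation: selections of [y] precede [y], so the list built just before [y]
    joins already contains the selected descendant. *)
Lemma descendant_dec s n x : (forall y j, (1 < y)%N -> (0 < s y j < y)%N) ->
  (0 < r)%N ->
  descendant s r x -> (x <= r + n)%N -> x \in desc_list (hist [set: 'I_m] s n).
Proof.
move=> s_lt r0 dx; elim: dx n => [n _|y j ry dj IH n yn]; first exact: r_in_dec.
pose k := (y - r).-1; have yk : y = (r + k).+1 by rewrite /k; lia.
apply: (@sub_dec_hist _ _ k.+1); first by lia.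
rewrite /= ifT; first by rewrite size_hist -yk inE eqxx.
apply/existsP; exists j; rewrite inE /= -yk; apply: IH.
by have := s_lt y j; lia.
Qed.

Lemma dec_descendant J s n x : x \in desc_list (hist J s n) -> descendant s r x.
Proof.
elim: n x => [|n IH] x /=; first by rewrite inE => /eqP ->; constructor.
case: ifPn => [/existsP[j /andP[_ sj]]|_]; last exact: IH.
rewrite inE => /orP[/eqP ->|]; last exact: IH.
rewrite size_hist; apply: (@descendant_select _ _ _ _ j); last exact: IH.
by rewrite ltnS leq_addr.
Qed.

(** Two duplicate-free lists with the same members have the same length. *)
Lemma num_descendantsE s n : (forall y j, (1 < y)%N -> (0 < s y j < y)%N) ->
  (0 < r)%N -> num_descendants s r (r + n) = ndesc (hist [set: 'I_m] s n).
Proof.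
move=> s_lt r0; rewrite /num_descendants -big_filter sum1_size -size_dec.
apply/perm_size/uniq_perm; rewrite ?filter_uniq ?iota_uniq ?dec_uniq//.
move=> x; rewrite mem_filter mem_index_iota; apply/idP/idP.
  by move=> /andP[/asboolP dx /andP[_ xn]]; exact: descendant_dec.
move=> xd; have := dec_bounds xd; rewrite size_hist => xb.
by apply/andP; split; [apply/asboolP; exact: dec_descendant xd|lia].
Qed.

End selection_path.

(** * Independence of past and future selections *)

Section selection_law.
Variables (R : realType) (d : measure_display) (T : measurableType d).
Variables (P : probability T R) (m : nat) (S : nat -> 'I_m -> {RV P >-> nat}).
Hypothesis hS : uniform_attachment S.

Lemma P_setU (A B : set T) : measurable A -> measurable B ->
  A `&` B = set0 -> P (A `|` B) = (P A + P B)%E.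
Proof. exact: measureU. Qed.

Definition cyl (I : {fset nat * 'I_m}) (A : nat * 'I_m -> set nat) : set T :=
  \bigcap_(i in [set` I]) (S i.1 i.2 @^-1` A i).

Lemma measurable_S x j (A : set nat) : measurable (S x j @^-1` A).
Proof. by rewrite -[X in measurable X]setTI; exact: measurable_funPT. Qed.

Lemma measurable_cyl I A : measurable (cyl I A).
Proof. by apply: fin_bigcap_measurable => // i _; exact: measurable_S. Qed.

Lemma P_cyl (I : {fset nat * 'I_m}) A : (forall i, i \in I -> (1 < i.1)%N) ->
  P (cyl I A) = (\prod_(i <- I) P (S i.1 i.2 @^-1` A i))%E.
Proof. by case: hS => S_indep _ I1; exact: S_indep. Qed.

(** The index sets are disjoint, so gluing [A1] and [A2] along the vertex index gives one cylinder,
    over which independence factorises. *)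
Lemma P_cylU (I1 I2 : {fset nat * 'I_m}) A1 A2 n : (0 < n)%N ->
  (forall i, i \in I1 -> i.1 = n.+1) -> (forall i, i \in I2 -> (n.+1 < i.1)%N) ->
  exists A, cyl I1 A1 `&` cyl I2 A2 = cyl (I1 `|` I2)%fset A /\
    P (cyl (I1 `|` I2)%fset A) = (P (cyl I1 A1) * P (cyl I2 A2))%E.
Proof.
move=> n0 HI1 HI2; exists (fun i => if i.1 == n.+1 then A1 i else A2 i).
have ne2 i : i \in I2 -> (i.1 == n.+1) = false.
  by move=> /HI2 ni; apply/eqP; lia.
have eq1 i : i \in I1 -> (i.1 == n.+1) = true by move=> /HI1 ->; exact: eqxx.
split.
  apply/seteqP; split => w /=.
    move=> [w1 w2] i /=; rewrite in_fsetU => /orP[iI|iI].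
      by rewrite eq1//; exact: w1.
    by rewrite ne2//; exact: w2.
  move=> wA; split => i /= iI.
    by have := wA i; rewrite /= in_fsetU iI eq1//; exact.
  by have := wA i; rewrite /= in_fsetU iI orbT ne2//; exact.
have gt1 i : i \in I1 -> (1 < i.1)%N by move=> /HI1 ->; rewrite ltnS.
have gt2 i : i \in I2 -> (1 < i.1)%N by move=> /HI2; lia.
have gtU i : i \in (I1 `|` I2)%fset -> (1 < i.1)%N.
  by rewrite in_fsetU => /orP[/gt1|/gt2].
rewrite (P_cyl _ gtU) (P_cyl _ gt1) (P_cyl _ gt2).
rewrite (perm_big (I1 ++ I2)); last first.
  apply: uniq_perm; rewrite ?fset_uniq// ?cat_uniq ?fset_uniq//=.
    rewrite andbT; apply/hasPn => i /ne2; apply: contraFN => /HI1 ->.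
    by rewrite eqxx.
  by move=> i; rewrite in_fsetU mem_cat.
rewrite big_cat /=; congr (_ * _)%E; rewrite big_seq [RHS]big_seq.
  by apply: eq_bigr => i /eq1 ->.
by apply: eq_bigr => i /ne2 ->.
Qed.

(** Replaces membership in the past up to time [n]: independence, tested on cylinders, from all
    selections of later vertices. *)
Definition future_indep (n : nat) (E : set T) : Prop := measurable E /\
  forall (I : {fset nat * 'I_m}) A, (forall i, i \in I -> (n < i.1)%N) ->
    P (E `&` cyl I A) = (P E * P (cyl I A))%E.

Lemma future_indepT n : future_indep n setT.
Proof. by split=> // I A _; rewrite setTI probability_setT mul1e. Qed.

Lemma future_indepI n E (I0 : {fset nat * 'I_m}) A0 : (0 < n)%N -> future_indep n E ->
  (forall i, i \in I0 -> i.1 = n.+1) ->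
  future_indep n.+1 (E `&` cyl I0 A0).
Proof.
move=> n0 [mE fE] HI0; split; first exact: measurableI (measurable_cyl _ _).
move=> I A HI; rewrite -setIA.
have [A' [-> PA']] := P_cylU A0 A n0 HI0 HI.
rewrite fE; last by move=> i; rewrite in_fsetU => /orP[/HI0 ->//|/HI]; lia.
by rewrite PA' fE ?muleA// => i /HI0 ->.
Qed.

(** Probabilities of nested differences subtract, so the product rule is inherited. This covers
    hits, which are complements of cylinders. *)
Lemma future_indepD n E F : future_indep n E -> future_indep n F ->
  F `<=` E -> future_indep n (E `\` F).
Proof.
move=> [mE fE] [mF fF] FE; split; first exact: measurableD.
move=> I A HI; have mC := measurable_cyl I A.
have EF : (E `\` F) `&` cyl I A = (E `&` cyl I A) `\` (F `&` cyl I A).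
  apply/seteqP; split => w /=; first by move=> [[? ?] ?]; split=> // -[].
  by move=> [[? ?] nF]; split=> //; split=> // ?; exact: nF.
have PD (X Y : set T) : measurable X -> measurable Y -> Y `<=` X ->
    P (X `\` Y) = (P X - P Y)%E.
  move=> mX mY YX; rewrite measureD//; first by rewrite setIC setIidl.
  by rewrite ltey_eq fin_num_measure.
rewrite EF !PD//; [|exact: measurableI..|exact: setSI].
rewrite fE// fF//.
have : P E \is a fin_num by rewrite fin_num_measure.
have : P F \is a fin_num by rewrite fin_num_measure.
have : P (cyl I A) \is a fin_num by rewrite fin_num_measure.
move: (P E) (P F) (P (cyl I A)) => [e| |] [f| |] [c| |] // _ _ _.
by rewrite -[RHS]/(((e - f) * c)%:E) mulrBl.
Qed.

Lemma P_miss (x : nat) (j : 'I_m) (D : seq nat) : (1 < x)%N -> uniq D ->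
  (forall k, k \in D -> (0 < k < x)%N) ->
  P (S x j @^-1` ~` [set` D]) = (1 - (size D)%:R / x.-1%:R)%:E.
Proof.
move=> x1 uD Dx; rewrite -preimage_setC (probability_setC _ (measurable_S _ _ _)).
have -> : P (S x j @^-1` [set` D]) = ((size D)%:R / x.-1%:R)%:E; last first.
  by rewrite -EFinB.
elim: D uD Dx => [|k D IH] /=.
  by move=> _ _; rewrite mul0r (_ : [set` [::]] = set0) ?preimage_set0 ?measure0//;
    apply/seteqP; split.
move=> /andP[kD uD] Dx.
have -> : [set` k :: D] = [set k] `|` [set` D] :> set nat.
  apply/seteqP; split => y /=; first by rewrite inE => /orP[/eqP|]; [left|right].
  by move=> [->|yD]; rewrite inE ?eqxx// yD orbT.
have disj : S x j @^-1` [set k] `&` S x j @^-1` [set` D] = set0.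
  by apply/seteqP; split => // w /= [->]; rewrite (negPf kD).
rewrite preimage_setU (P_setU (measurable_S _ _ _) (measurable_S _ _ _) disj).
rewrite IH//; last by move=> y yD; apply: Dx; rewrite inE yD orbT.
rewrite (proj2 hS)// Dx ?inE ?eqxx// -EFinD -natr1 mulrDl mul1r; congr (_%:E).
by rewrite addrC.
Qed.

(** * The law of the random history *)

Section history_law.
Variables (r : nat) (J : {set 'I_m}).
Hypothesis r_gt1 : (1 < r)%N.
Let K := #|J|.
Implicit Types (h : seq bool) (n : nat).

Definition rhist n (w : T) : seq bool := hist r J (fun x j => S x j w) n.

Lemma rhistS n w :
  rhist n.+1 w =
  hit J (fun j => S (r + n).+1 j w) (desc_list r (rhist n w)) :: rhist n w.
Proof. by []. Qed.

Definition hist_event h : set T := [set w | rhist (size h) w = h].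

(** A miss constrains every selection in [J] separately and is thus a cylinder; hits are handled as
    complements of misses. *)
Definition miss_event h : set T :=
  cyl [fset ((r + size h).+1, j) | j in J]%fset (fun=> ~` [set` desc_list r h]).

Lemma miss_eventE h :
  miss_event h =
  [set w | hit J (fun j => S (r + size h).+1 j w) (desc_list r h) = false].
Proof.
apply/seteqP; split => w /=.
  move=> wm; apply/existsP => -[j /andP[jJ]].
  by apply/negP/negP; apply: (wm (_, j)); rewrite /= in_imfset.
move=> /existsPn nh i /= /imfsetP[j /= jJ ->] /= sj.
by have := nh j; rewrite jJ sj.
Qed.

Lemma P_miss_event h : P (miss_event h) = ((1 - desc_prop R r h) ^+ K)%:E.
Proof.
rewrite P_cyl; last by move=> i /imfsetP[j _ ->] /=; rewrite ltnS; lia.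
rewrite big_imfset /=; last by move=> i j _ _ [].
rewrite (eq_bigr (fun=> (1 - desc_prop R r h)%:E)); last first.
  move=> j _; rewrite P_miss ?size_dec ?dec_uniq//; first by lia.
  by move=> k /dec_bounds; lia.
rewrite prodEFin; congr (_%:E); rewrite big_enum /=.
by rewrite prodr_const.
Qed.

Lemma hist_event_cons b h : hist_event (b :: h) =
  if b then hist_event h `\` miss_event h else hist_event h `&` miss_event h.
Proof.
rewrite miss_eventE; apply/seteqP; split => w; rewrite /hist_event.
  rewrite /= rhistS => -[hb hh]; rewrite hh in hb.
  by case: b hb => hb; split=> //=; rewrite hb.
case: b => /= -[hh hb]; rewrite rhistS hh; congr (_ :: _); last exact: hb.
by case: hit hb => // /(_ erefl).
Qed.

Lemma hist_event_indep h : future_indep (r + size h)%N (hist_event h).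
Proof.
elim: h => [|b h IH].
  by rewrite (_ : hist_event [::] = setT); [exact: future_indepT|apply/seteqP; split].
have fI : future_indep (r + size (b :: h))%N (hist_event h `&` miss_event h).
  rewrite /= addnS; apply: future_indepI IH _; first by lia.
  by move=> i /imfsetP[j _ ->].
rewrite hist_event_cons; case: b fI => // fI.
(* [future_indepD] needs the removed event inside the first one, so the miss is intersected with
   [hist_event h]. *)
rewrite -[X in future_indep _ X](_ :
  hist_event h `\` (hist_event h `&` miss_event h) = _); last first.
  by rewrite setDIr setDv set0U.
apply: future_indepD fI _ => //.
case: IH => mE fE; split => // I A HI; apply: fE => i /HI; rewrite /=; lia.
Qed.

Lemma measurable_hist_event h : measurable (hist_event h).
Proof. by have [] := hist_event_indep h. Qed.

Lemma P_hist_event_false h :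
  P (hist_event (false :: h)) = (P (hist_event h) * (1 - hitp R r K h)%:E)%E.
Proof.
rewrite hist_event_cons; have [_ ->] := hist_event_indep h.
  by rewrite P_miss_event /hitp subKr.
by move=> i /imfsetP[j _ ->] /=.
Qed.

Lemma hist_event_split h :
  hist_event h = hist_event (true :: h) `|` hist_event (false :: h).
Proof. by rewrite !hist_event_cons setUC setUIDK. Qed.

Lemma hist_event_disj h :
  hist_event (true :: h) `&` hist_event (false :: h) = set0.
Proof.
by apply/seteqP; split => // w []; rewrite /hist_event /= => -> [].
Qed.

(** By subtraction: the two extensions of [h] partition [hist_event h], and the probability of the
    miss is known. *)
Lemma P_hist_event_true h :
  P (hist_event (true :: h)) = (P (hist_event h) * (hitp R r K h)%:E)%E.
Proof.
have := P_hist_event_false h.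
have := P_setU (measurable_hist_event (true :: h))
  (measurable_hist_event (false :: h)) (hist_event_disj h).
rewrite -hist_event_split.
have : P (hist_event h) \is a fin_num.
  by rewrite fin_num_measure//; exact: measurable_hist_event.
have : P (hist_event (true :: h)) \is a fin_num.
  by rewrite fin_num_measure//; exact: measurable_hist_event.
move: (P (hist_event h)) (P (hist_event (true :: h))) (P (hist_event (false :: h))).
move=> [x| |] [y| |] [z| |] // _ _.
rewrite -[(x%:E * (1 - _)%:E)%E]/((x * (1 - hitp R r K h))%:E) => -[e1] [e2].
by rewrite -EFinM; congr (_%:E); lra.
Qed.

(** Only finitely many histories have a given length; the induction splits [hist_event h] with [k]
    steps remaining. *)
Lemma measurable_rhist n (A : set (seq bool)) :
  measurable [set w | A (rhist n w)].
Proof.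
suff H k h : measurable (hist_event h `&` [set w | A (rhist (size h + k) w)]).
  by have := H n [::]; rewrite (_ : hist_event [::] = setT) ?setTI//; apply/seteqP; split.
elim: k h => [|k IH] h.
  rewrite addn0; have [Ah|nAh] := pselect (A h).
    rewrite (_ : _ `&` _ = hist_event h); first exact: measurable_hist_event.
    by apply/seteqP; split => w /= [] //; rewrite /hist_event /= => ->.
  rewrite (_ : _ `&` _ = set0)//.
  by apply/seteqP; split => // w /= []; rewrite /hist_event /= => ->.
rewrite hist_event_split setIUl -addSnnS; apply: measurableU.
  exact: (IH (true :: h)).
exact: (IH (false :: h)).
Qed.

(** Transfers computations with [expect] to the process. Starting from an arbitrary [h] makes the
    induction follow the recursion of [expect]. *)
Lemma P_rhist n (A : pred (seq bool)) :
  P [set w | A (rhist n w)] = (expect r K [::] n (fun h => (A h)%:R : R))%:E.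
Proof.
have ev0 : hist_event [::] = setT by apply/seteqP; split.
suff H k h : P (hist_event h `&` [set w | A (rhist (size h + k) w)]) =
    (P (hist_event h) * (expect r K h k (fun h => (A h)%:R : R))%:E)%E.
  by have := H n [::]; rewrite ev0 setTI probability_setT mul1e.
elim: k h => [|k IH] h.
  rewrite addn0 /=; have [Ah|nAh] := boolP (A h).
    rewrite mule1; congr (P _).
    by apply/seteqP; split => w /= [] //; rewrite /hist_event /= => ->.
  rewrite mule0 (_ : _ `&` _ = set0) ?measure0//.
  by apply/seteqP; split => // w /= []; rewrite /hist_event /= => ->; rewrite (negPf nAh).
rewrite {1}hist_event_split setIUl P_setU; last first.
- by rewrite setIACA hist_event_disj set0I.
- apply: measurableI; first exact: measurable_hist_event.
  exact: (measurable_rhist _ [set h | A h]).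
- apply: measurableI; first exact: measurable_hist_event.
  exact: (measurable_rhist _ [set h | A h]).
have := IH (true :: h); have := IH (false :: h).
rewrite /= !addSnnS => -> ->; rewrite P_hist_event_false P_hist_event_true.
have : P (hist_event h) \is a fin_num.
  by rewrite fin_num_measure//; exact: measurable_hist_event.
move: (P (hist_event h)) => [x| |] // _.
by rewrite -!EFinM -EFinD; congr (_%:E); ring.
Qed.

End history_law.
End selection_law.

(** * Almost-sure statements and limits of probabilities *)

Section probability_limits.
Variables (R : realType) (d : measure_display) (T : measurableType d).
Variable P : probability T R.

Lemma ae_sub (A B : T -> Prop) :
  almost_everywhere P A -> (forall w, A w -> B w) -> almost_everywhere P B.
Proof.
move=> aeA AB; apply: negligibleS aeA => w /= nB Aw; exact/nB/AB.
Qed.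

Lemma ae_and (A B : T -> Prop) : almost_everywhere P A ->
  almost_everywhere P B -> almost_everywhere P (fun w => A w /\ B w).
Proof.
move=> aeA aeB; apply: negligibleS (negligibleU aeA aeB) => w /= nAB.
have [Aw|nA] := pselect (A w); [right|by left].
by move=> Bw; exact: nAB.
Qed.

Lemma ae_forall_nat (A : nat -> T -> Prop) :
  (forall n, almost_everywhere P (A n)) ->
  almost_everywhere P (fun w => forall n, A n w).
Proof. exact: ae_foralln. Qed.

Lemma P_le (A B : set T) : measurable A -> measurable B -> A `<=` B ->
  (P A <= P B)%E.
Proof. by move=> mA mB AB; apply: le_measure; rewrite ?inE. Qed.

Lemma P_bigcup_le (F : nat -> set T) (c : \bar R) :
  (forall n, measurable (F n)) -> nondecreasing_seq F ->
  (forall n, (P (F n) <= c)%E) -> (P (\bigcup_n F n) <= c)%E.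
Proof.
move=> mF ndF Fc.
have mU : measurable (\bigcup_n F n) by exact: bigcup_measurable.
have cF : P (F n) @[n --> \oo] --> P (\bigcup_n F n).
  exact: nondecreasing_cvg_mu.
rewrite -(cvg_lim _ cF)//; apply: lime_le; first by apply/cvg_ex; eexists; exact: cF.
by apply: nearW => n; exact: Fc.
Qed.

Lemma P_ae_le (A B : set T) : measurable A -> measurable B ->
  {ae P, forall w, A w -> B w} -> (P A <= P B)%E.
Proof.
move=> mA mB [N [mN PN AB]].
apply: (@le_trans _ _ (P (B `|` N))%E).
  apply: P_le => //; first exact: measurableU.
  move=> w Aw; have [Bw|nBw] := pselect (B w); [by left|right].
  by apply: AB => /= AwBw; exact/nBw/AwBw.
apply: le_trans (measureU2 P mB mN) _.
by rewrite [X in (_ + X)%E]PN adde0.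
Qed.

(** A Fatou bound: [A] lies almost surely in the lower limit of the [E n], the increasing union of
    the tail intersections [F N]. *)
Lemma P_eventually_le (E : nat -> set T) (A : set T) (l : R) :
  measurable A -> (forall n, measurable (E n)) ->
  {ae P, forall w, A w -> \forall n \near \oo, E n w} ->
  P (E n) @[n --> \oo] --> l%:E -> (P A <= l%:E)%E.
Proof.
move=> mA mE AE El.
pose F N := \bigcap_(n in [set n | (N <= n)%N]) E n.
have mF N : measurable (F N) by exact: bigcap_measurableType.
have ndF : nondecreasing_seq F.
  move=> N1 N2 N12; apply/subsetPset => w FN1 n /= N2n; apply: FN1.
  exact: leq_trans N12 N2n.
apply: (@le_trans _ _ (P (\bigcup_N F N))).
  apply: P_ae_le => //; first exact: bigcup_measurable.
apply: P_bigcup_le => // N.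
rewrite -(cvg_lim _ El)//; apply: lime_ge; first by apply/cvg_ex; exists l%:E.
by exists N => // n /= Nn; apply: P_le => // w; exact.
Qed.

End probability_limits.

(** * Laws on the line and the minimum of uniforms *)

Lemma measureR_unique (R : realType) (m1 m2 : {measure set R -> \bar R}) :
  (forall x : R, m1 `]x, +oo[%classic = m2 `]x, +oo[%classic) ->
  (forall x : R, (m1 `]x, +oo[%classic < +oo)%E) ->
  forall A, measurable A -> m1 A = m2 A.
Proof.
move=> m12 m1oo A mA.
(* Open upper rays are stable under intersection and generate the Borel sets; those starting at
   [- k%:R] exhaust the line. *)
apply: (@measure_unique _ R _ (@measurable_realfun.RGenOInfty.G R)
  (fun k => `](- k%:R), +oo[%classic)) => //.
- exact: measurable_realfun.RGenOInfty.measurableE.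
- move=> _ _ [x ->] [y ->]; exists (Num.max x y).
  apply/seteqP; split => z /=; rewrite !in_itv/= !andbT gt_max.
    by move=> [-> ->].
  by move=> /andP[-> ->].
- by move=> i; eexists.
- apply/seteqP; split => // x _; exists (Num.truncn `|x|).+1 => //=.
  rewrite in_itv/= andbT ltrNl; apply: le_lt_trans (truncnS_gt _).
  by rewrite -normrN ler_norm.
- by move=> _ [x ->].
Qed.

Lemma uniform_prob_gt (R : realType) (x : R) : 0 <= x <= 1 ->
  uniform_prob (@ltr01 R) `]x, +oo[%classic = (1 - x)%:E.
Proof.
move=> /andP[x0 x1]; rewrite /uniform_prob integral_uniform_pdf.
have -> : `]x, +oo[%classic `&` `[0, 1]%classic = `]x, 1]%classic :> set R.
  apply/seteqP; split => y /=; rewrite !in_itv/= ?andbT.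
    by move=> [-> /andP[_ ->]].
  by move=> /andP[xy ->]; rewrite xy (ltW (le_lt_trans x0 xy)).
rewrite (eq_integral (fun=> 1%:E)); last first.
  move=> y; rewrite inE /= in_itv/= => /andP[xy y1].
  by rewrite /uniform_pdf y1 (ltW (le_lt_trans x0 xy)) subr0 invr1.
rewrite integral_cst//= mul1e lebesgue_measure_itv/= lte_fin.
case: ltP => [_|lx]; first by rewrite EFinB.
by have -> : x = 1 by [apply/eqP; rewrite eq_le x1]; rewrite subrr.
Qed.

(** The tail of the minimum of [n] independent uniforms; clamping [x] to [[0, 1]] makes the formula
    valid on the whole line when [n > 0]. *)
Definition min_tail (R : realType) (n : nat) (x : R) : R :=
  (1 - Num.min 1 (Num.max 0 x)) ^+ n.

(** The neutral element [1] caps the minimum, hence the empty preimage once [1 <= x]. *)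
Lemma family_min_gt (T : Type) (R : realType) (n : nat) (U : 'I_n -> T -> R) x :
  family_min U @^-1` `]x, +oo[%classic =
  if x < 1 then \bigcap_i (U i @^-1` `]x, +oo[%classic) else set0.
Proof.
have H w : (x < family_min U w) = (x < 1) && [forall i, x < U i w].
  rewrite /family_min; apply/idP/idP.
    move=> xm; apply/andP; split.
      by apply: lt_le_trans xm _; exact: bigmin_le_id.
    by apply/forallP => i; apply: lt_le_trans xm _; exact: bigmin_le_cond.
  by move=> /andP[x1 /forallP xU]; apply/bigmin_gtP; split=> // i _.
apply/seteqP; split => w /=; rewrite ?in_itv/= ?andbT.
  rewrite H => /andP[-> /forallP xU] i _ /=.
  by rewrite ?in_itv /= ?andbT; exact: xU.
case: ifPn => // x1 xU; rewrite ?in_itv /= ?andbT H x1; apply/forallP => i.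
by have := xU i I; rewrite /= in_itv /= andbT.
Qed.

Lemma family_min_tail (R : realType) (d : measure_display) (T : measurableType d)
    (Q : probability T R) (n : nat) (U : 'I_n -> {RV Q >-> R}) (x : R) :
  (0 < n)%N -> iid_uniform01 U ->
  Q (family_min (fun i w => U i w) @^-1` `]x, +oo[%classic) = (min_tail n x)%:E.
Proof.
move=> n0 [Uind Ulaw].
rewrite family_min_gt; case: ifPn => [x1|]; last first.
  rewrite -leNgt => x1; rewrite measure0 /min_tail.
  rewrite (max_idPr _); last by apply: le_trans x1.
  by rewrite (min_idPl x1) subrr expr0n gtn_eqF.
have := Uind [fset i | i in 'I_n]%fset (fun=> `]x, +oo[%classic).
have -> : [set` [fset i | i in 'I_n]%fset] = setT :> set 'I_n.
  by apply/seteqP; split => // i _; apply/imfsetP; exists i.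
move=> -> //; rewrite big_imfset//= big_enum /=.
rewrite (eq_bigr (fun=> (1 - Num.min 1 (Num.max 0 x))%:E)); last first.
  move=> i _; rewrite -[LHS]/(distribution Q (U i) _) Ulaw//.
  (* For [x < 0] the ray contains []0, +oo[], which already has mass 1. *)
  have [x0|x0] := ltP x 0.
    rewrite (min_idPr _) ?ler01// subr0; apply/eqP; rewrite eq_le probability_le1//=.
    rewrite -[X in (X <= _)%E](_ : uniform_prob (@ltr01 R) `]0, +oo[%classic = _).
      by apply: P_le => //; move=> y /=; rewrite !in_itv/= !andbT; exact: lt_trans.
    by rewrite uniform_prob_gt ?lexx ?ler01// subr0.
  by rewrite (min_idPr (ltW x1)) uniform_prob_gt// x0 ltW.
by rewrite prodEFin prodr_const card_ord.
Qed.

(** * The limit of the urn formula *)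

Section falling_factorial_limit.
Variables (R : realType) (r : nat).
Hypothesis r_gt0 : (0 < r)%N.

Lemma ratio_cvg (u : nat -> R) (c B : R) :
  (forall n, `|u n - c * (r + n)%:R| <= B) -> u n / (r + n)%:R @[n --> \oo] --> c.
Proof.
move=> uB; apply/cvgrPdist_le => e e0; exists (Num.truncn (B / e)) => // n /= Nn.
have t0 : 0 < (r + n)%:R :> R by rewrite ltr0n addn_gt0 r_gt0.
have -> : c - u n / (r + n)%:R = - (u n - c * (r + n)%:R) / (r + n)%:R.
  by rewrite mulNr mulrBl mulfK ?gt_eqF// opprB.
rewrite normrM normrN normfV (gtr0_norm t0) ler_pdivrMr//.
apply: le_trans (uB n) _; rewrite mulrC -ler_pdivrMr//; apply: ltW.
apply: lt_le_trans (truncnS_gt _) _; rewrite ler_nat.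
by apply: leq_ltn_trans Nn _; rewrite -[ltnLHS]add0n ltn_add2r.
Qed.

(** Each further factor contributes a quotient [num n / den n], whose numerator and denominator are
    linear in [n] up to a bounded error and tend to [1 - x] and [1]. *)
Lemma ffact_ratio_cvg (x : R) s : 0 <= x <= 1 ->
  (((r + n).-1 - Num.truncn (x * (r + n)%:R)) ^_ s)%:R / ((r + n).-1 ^_ s)%:R
    @[n --> \oo] --> (1 - x) ^+ s.
Proof.
move=> /andP[x0 x1]; elim: s => [|s IH].
  under eq_fun do rewrite !ffactn0 divr1.
  by rewrite expr0; exact: cvg_cst.
pose k n := Num.truncn (x * (r + n)%:R : R).
pose num n : R := ((r + n).-1 - k n - s)%:R / (r + n)%:R.
pose den n : R := ((r + n).-1 - s)%:R / (r + n)%:R.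
have t0 n : 0 < (r + n)%:R :> R by rewrite ltr0n addn_gt0 r_gt0.
have cnum : num n @[n --> \oo] --> 1 - x.
  apply: (@ratio_cvg (fun n => ((r + n).-1 - k n - s)%:R) _ (s%:R + 2)) => n.
  have := truncn_itv (mulr_ge0 x0 (ltW (t0 n))); rewrite -/(k n).
  have := ler_wpM2r (ltW (t0 n)) x1; rewrite mul1r.
  rewrite mulrBl mul1r; set y := x * _ => yt /andP[ky]; rewrite -natr1 => yk.
  (* In the second case natural subtraction truncates to 0, but then [r + n] exceeds [k n] by less
     than [s + 1], so the error stays bounded. *)
  have [skt|tsk] := leqP (k n + s + 1) (r + n).
    have -> : ((r + n).-1 - k n - s)%:R = (r + n)%:R - (k n)%:R - s%:R - 1 :> R.
      have -> : (r + n)%:R = ((r + n).-1 - k n - s)%:R + ((k n)%:R + s%:R + 1) :> R.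
        by rewrite -[1]/(1%:R) -!natrD; congr (_%:R); lia.
      by lra.
    have s0 : 0 <= s%:R :> R by [].
    by rewrite ler_norml; apply/andP; split; lra.
  have -> : ((r + n).-1 - k n - s = 0)%N by lia.
  have : (r + n)%:R <= (k n)%:R + s%:R + 1 :> R.
    by rewrite -[1]/(1%:R) -!natrD ler_nat; lia.
  have s0 : 0 <= s%:R :> R by [].
  by move=> le_t; rewrite mulr0n ler_norml; apply/andP; split; lra.
have cden : den n @[n --> \oo] --> (1 : R).
  apply: (@ratio_cvg (fun n => ((r + n).-1 - s)%:R) _ (s%:R + 1)) => n.
  rewrite mul1r; have [skt|tsk] := leqP (s + 1) (r + n).
    have -> : ((r + n).-1 - s)%:R = (r + n)%:R - s%:R - 1 :> R.
      have -> : (r + n)%:R = ((r + n).-1 - s)%:R + (s%:R + 1) :> R.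
        by rewrite -[1]/(1%:R) -!natrD; congr (_%:R); lia.
      by lra.
    have s0 : 0 <= s%:R :> R by [].
    by rewrite ler_norml; apply/andP; split; lra.
  have -> : ((r + n).-1 - s = 0)%N by lia.
  have : (r + n)%:R <= s%:R + 1 :> R.
    by rewrite -[1]/(1%:R) -!natrD ler_nat; lia.
  by move=> le_t; have := t0 n; rewrite mulr0n ler_norml => t00; apply/andP; split; lra.
rewrite exprSr (_ : (1 - x) ^+ s * (1 - x) = (1 - x) ^+ s * ((1 - x) / 1)); last first.
  by rewrite divr1.
rewrite (_ : (fun n => _) = (fun n =>
  (((r + n).-1 - k n) ^_ s)%:R / ((r + n).-1 ^_ s)%:R * (num n / den n))).
  apply: cvgM; first exact: IH.
  by apply: cvgM; [exact: cnum|apply: cvgV => //; rewrite oner_neq0].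
apply/funext => n; rewrite !ffactnSr !natrM invfM mulrACA; congr (_ * _).
by rewrite /num /den invf_div mulrA divfK ?gt_eqF.
Qed.

End falling_factorial_limit.

(** * Almost-sure convergence of the proportion *)

Section attachment.
Variables (R : realType) (d : measure_display) (T : measurableType d).
Variables (P : probability T R) (m : nat) (S : nat -> 'I_m -> {RV P >-> nat}).
Hypothesis hS : uniform_attachment S.

(** The [y.-1] point masses on [[1, y.-1]] already sum to 1. The pathwise counting lemmas need this
    bound. *)
Lemma selections_below_ae :
  almost_everywhere P (fun w => forall y j, (1 < y)%N -> (0 < S y j w < y)%N).
Proof.
apply: ae_forall_nat => y; have [y1|y1] := leqP y 1.
  by apply: (@ae_sub _ _ _ _ setT) => [|w _ j]; [exact: aeW|lia].
apply: (@ae_sub _ _ _ _ (fun w => forall j, (0 < S y j w < y)%N)) => //.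
have H j : almost_everywhere P (fun w => (0 < S y j w < y)%N).
  exists (S y j @^-1` ~` [set` iota 1 y.-1]); split.
  - exact: measurable_S.
  - rewrite (P_miss hS)// ?iota_uniq// ?size_iota.
      by rewrite divff ?subrr// pnatr_eq0; lia.
    by move=> k; rewrite mem_iota; lia.
  - by move=> w /= nS; rewrite mem_iota => ?; apply: nS; lia.
(* The finite quantifier over ['I_m] is turned into a countable one over [nat]. *)
have : almost_everywhere P (fun w => forall n (nm : (n < m)%N),
    (0 < S y (Ordinal nm) w < y)%N).
  apply: ae_forall_nat => n; have [nm|mn] := pselect (n < m)%N.
    by apply: (ae_sub (H (Ordinal nm))) => w Sy nm';
      rewrite (_ : Ordinal nm' = Ordinal nm)//; exact: val_inj.
  by apply: (@ae_sub _ _ _ _ setT) => [|w _ nm]; [exact: aeW|].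
by move=> /ae_sub; apply => w Sw [n nm]; exact: Sw.
Qed.

Variables (r : nat) (J : {set 'I_m}).
Hypothesis r_gt1 : (1 < r)%N.
Let r_gt0 : (0 < r)%N := ltnW r_gt1.
Let K := #|J|.
Local Notation H := (rhist S r J).

(** For each level [a j], reaching it after every starting time [k] has probability at most
    [a j ^- 2 / (r + k)] for all [k], hence zero. *)
Lemma mart_cvg_ae :
  almost_everywhere P (fun w => cvgn (martingale R r K \o H^~ w)).
Proof.
pose a j : R := j.+1%:R^-1.
have a0 j : 0 < a j by rewrite invr_gt0.
pose F j k n := [set w | a j <= `|stopped r K k (a j) (H n w)|].
have mF j k n : measurable (F j k n).
  exact: (measurable_rhist hS J r_gt1 n [set h | a j <= `|stopped r K k (a j) h|]).
have PF j k : (P (\bigcup_n F j k n) <= (a j ^- 2 * (r + k)%:R^-1)%:E)%E.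
  apply: P_bigcup_le => // [n1 n2 n12|n].
    apply/subsetPset => w; rewrite /F /=.
    exact: (@stopped_le R r K (fun n => hit J (fun j => S (r + n).+1 j w)
      (desc_list r (H n w))) (H^~ w)).
  rewrite /F (P_rhist hS J r_gt1 n (fun h => a j <= `|stopped r K k (a j) h|)).
  by rewrite lee_fin; exact: stopped_tail.
apply: (@ae_sub _ _ _ _ (fun w => forall j, exists k, forall i, ~ F j k i w)).
  apply: ae_forall_nat => j; exists (\bigcap_k \bigcup_n F j k n); split.
  - by apply: bigcapT_measurable => k; exact: bigcup_measurable.
  - set N := \bigcap_k _; have mN : measurable N.
      by apply: bigcapT_measurable => k; exact: bigcup_measurable.
    have PN k : (P N <= (a j ^- 2 * (r + k)%:R^-1)%:E)%E.
      apply: le_trans (PF j k); apply: P_le => //; first exact: bigcup_measurable.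
      by move=> w; exact.
    have : P N \is a fin_num by rewrite fin_num_measure.
    have : (0 <= P N)%E by [].
    move: (P N) PN => [x| |] // PN; rewrite lee_fin le_eqVlt => /orP[/eqP <-//|x0] _.
    (* If [P N] were some [x > 0], this [k] would make the bound smaller than [x]. *)
    have := PN (Num.truncn (a j ^- 2 / x)); set k := Num.truncn _.
    rewrite lee_fin ler_pdivlMr ?ltr0n ?addn_gt0 ?r_gt0//.
    rewrite mulrC -ler_pdivlMr// leNgt (lt_le_trans (truncnS_gt _))//.
    by rewrite -/k ler_nat; lia.
  - move=> w /= nw k _; apply: contrapT => nF; apply: nw; exists k => i Fi.
    by apply: nF; exists i.
move=> w Fw; apply: (@mart_cvg R r K (fun n => hit J (fun j => S (r + n).+1 j w)
      (desc_list r (H n w)))) => // j.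
by have [k Fk] := Fw j; exists k => i; rewrite ltNge; apply/negP; exact: Fk.
Qed.

Hypothesis K_gt0 : (0 < K)%N.

Lemma prop_cvg_ae :
  almost_everywhere P (fun w => cvgn (desc_prop R r \o H^~ w)).
Proof.
apply: (ae_sub mart_cvg_ae) => w.
exact: (@prop_cvg R r K _ (fun n => hit J (fun j => S (r + n).+1 j w)
      (desc_list r (H n w)))).
Qed.

End attachment.

(** * The limit law for a single selection *)

Lemma measurable_family_min (R : realType) (d : measure_display)
    (T : measurableType d) (n : nat) (U : 'I_n -> T -> R) :
  (forall i, measurable_fun setT (U i)) ->
  measurable_fun setT (family_min U).
Proof.
move=> mU mT.
apply: (measurability _ (measurable_realfun.RGenOInfty.measurableE R)) => //.
move=> _ [_ [x ->] <-]; rewrite setTI family_min_gt; case: ifP => // _.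
apply: fin_bigcap_measurable => // i _.
by rewrite -[X in measurable X]setTI; exact: mU.
Qed.

Lemma measurable_gt (R : realType) (d : measure_display) (T : measurableType d)
    (f : T -> R) (x : R) :
  measurable_fun setT f -> measurable [set w | x < f w].
Proof.
move=> mf.
rewrite (_ : [set w | _] = setT `&` f @^-1` `]x, +oo[%classic); first exact: mf.
by rewrite setTI; apply/seteqP; split => w /=; rewrite in_itv/= andbT.
Qed.

Section single_selection_limit.
Variables (R : realType) (d : measure_display) (T : measurableType d).
Variables (P : probability T R) (m : nat) (S : nat -> 'I_m -> {RV P >-> nat}).
Variables (r : nat) (J : {set 'I_m}).
Hypotheses (hS : uniform_attachment S) (r_gt1 : (1 < r)%N) (J1 : #|J| = 1%N).
Let r_gt0 : (0 < r)%N := ltnW r_gt1.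
Local Notation H := (rhist S r J).

(** The count is an integer, so it exceeds [x * t] exactly when it exceeds [truncn (x * t)]; the urn
    formula then applies. *)
Lemma P_prop_gt_cvg (x : R) : 0 <= x <= 1 ->
  P [set w | x < desc_prop R r (H n w)] @[n --> \oo] --> ((1 - x) ^+ r.-1)%:E.
Proof.
move=> x01; have /andP[x0 x1] := x01.
pose k n := Num.truncn (x * (r + n)%:R : R).
rewrite (_ : (fun n => _) = (fun n =>
    ((((r + n).-1 - k n) ^_ r.-1)%:R / ((r + n).-1 ^_ r.-1)%:R : R)%:E)).
  by apply: cvg_EFin; [exact: nearW|exact: ffact_ratio_cvg].
apply/funext => n; rewrite -(expect_tail R r_gt0 n (k n) J1 r_gt1).
rewrite -(P_rhist hS J r_gt1 n (fun h => (k n < ndesc h)%N)).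
congr (P _); apply/seteqP; split => w /=;
  rewrite /desc_prop size_hist ltr_pdivlMr ?ltr0n ?addn_gt0 ?r_gt0//;
  by rewrite truncn_lt_nat// mulr_ge0.
Qed.

Lemma measurable_desc_prop n :
  measurable_fun setT (fun w => desc_prop R r (H n w)).
Proof.
move=> _ Y mY; rewrite setTI.
exact: (measurable_rhist hS J r_gt1 n [set h | Y (desc_prop R r h)]).
Qed.

(** Convergence of tails bounds [P(x < L)] above and [P(x <= L)] below; continuity of the limiting
    tail closes the gap. *)
Lemma limit_tail (L : T -> R) : measurable_fun setT L ->
  almost_everywhere P (fun w => desc_prop R r \o H^~ w @ \oo --> L w) ->
  forall x, P [set w | x < L w] = (min_tail r.-1 x)%:E.
Proof.
move=> mL pL.
have mLgt x : measurable [set w | x < L w] by exact: measurable_gt.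
have mLlt x : measurable [set w | L w < x].
  rewrite (_ : [set w | _] = setT `&` L @^-1` `]-oo, x[%classic); first exact: mL.
  by rewrite setTI; apply/seteqP; split => w /=; rewrite in_itv.
have mp x n : measurable [set w | x < desc_prop R r (H n w)].
  exact: (measurable_rhist hS J r_gt1 n [set h | x < desc_prop R r h]).
have mpC x n : measurable [set w | desc_prop R r (H n w) <= x].
  exact: (measurable_rhist hS J r_gt1 n [set h | desc_prop R r h <= x]).
have ub (x : R) : 0 <= x <= 1 ->
    (P [set w | (x < L w)%R] <= ((1 - x) ^+ r.-1)%:E)%E.
  move=> x01; apply: (P_eventually_le (mLgt x) (mp x) _ (P_prop_gt_cvg x01)).
  by apply: (ae_sub pL) => w pLw /= xL; exact: (cvgr_gt (L w) pLw).
(* If [L w < x], then eventually [desc_prop <= x], an event whose probability tends to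
   [1 - (1 - x) ^+ r.-1]. *)
have lb (x : R) : 0 <= x <= 1 ->
    (((1 - x) ^+ r.-1)%:E <= P (~` [set w | (L w < x)%R]))%E.
  move=> x01; rewrite probability_setC//.
  have : (P [set w | (L w < x)%R] <= (1 - (1 - x) ^+ r.-1)%:E)%E.
    apply: (P_eventually_le (mLlt x) (mpC x)).
      by apply: (ae_sub pL) => w pLw /= xL; exact: (cvgr_le (L w) pLw).
    rewrite (_ : (fun n => _) =
      (fun n => 1 - P [set w | (x < desc_prop R r (H n w))%R])%E).
      rewrite EFinB; apply: cvgeB => //; first exact: cvg_cst.
      exact: P_prop_gt_cvg.
    apply/funext => n; rewrite -probability_setC//; congr (P _).
    by apply/seteqP; split => w /=; rewrite leNgt => /negP.
  have : P [set w | L w < x] \is a fin_num by rewrite fin_num_measure.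
  move: (P [set w | L w < x]) => [y| |] // _; rewrite -EFinB !lee_fin; lra.
have s0 : (0 < r.-1)%N by lia.
move=> x; apply/eqP; rewrite eq_le; apply/andP; split.
  have [x0|x0] := ltP x 0.
    rewrite /min_tail (max_idPl (ltW x0)) (min_idPr ler01) subr0 expr1n.
    exact: probability_le1.
  rewrite /min_tail (max_idPr x0); have [x1|x1] := leP x 1.
    by apply: ub; rewrite x0.
  apply: le_trans (ub 1 _); last by rewrite ler01 lexx.
  by apply: P_le => // w /=; exact: lt_trans.
have [x1|x1] := leP 1 x.
  rewrite /min_tail (max_idPr (le_trans ler01 x1)) (min_idPl x1) subrr expr0n.
  by rewrite gtn_eqF//=; exact: measure_ge0.
rewrite /min_tail (min_idPr _); last by rewrite ge_max ler01 ltW.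
set z := Num.max 0 x.
have z0 : 0 <= z by rewrite le_max lexx.
have z1 : z < 1 by rewrite gt_max ltr01.
have xz : x <= z by rewrite le_max lexx orbT.
(* [y n] tends to [z] from above within [[0, 1]], and [y n <= L w] implies the strict inequality
   [x < L w]. *)
pose y n : R := z + (1 - z) * n.+1%:R^-1.
have yz n : z < y n by rewrite ltrDl mulr_gt0// ?invr_gt0// subr_gt0.
have y1 n : y n <= 1.
  by rewrite /y -lerBrDl ler_piMr ?subr_ge0 ?(ltW z1)// invf_le1 ?ltr0n// ler1n.
have yc : y n @[n --> \oo] --> z.
  rewrite -[X in _ --> X]addr0; apply: cvgD; first exact: cvg_cst.
  rewrite -[X in _ --> X](mulr0 (1 - z)); apply: cvgM; first exact: cvg_cst.
  exact: cvg_harmonic.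
have : P [set w | x < L w] \is a fin_num by rewrite fin_num_measure.
have yP n : (((1 - y n) ^+ r.-1)%:E <= P [set w | (x < L w)%R])%E.
  apply: le_trans (lb (y n) _) _.
    by rewrite y1 (le_trans z0 (ltW (yz n))).
  apply: P_le => //; first exact: measurableC.
  by move=> w /= /negP; rewrite -leNgt; apply: lt_le_trans; exact: le_lt_trans (yz n).
move: (P [set w | x < L w]) yP => [q| |] // yP _; rewrite lee_fin.
have ql0 : 1 - y n @[n --> \oo] --> 1 - z.
  by apply: cvgB; [exact: cvg_cst|exact: yc].
have ql : (1 - y n) ^+ r.-1 @[n --> \oo] --> (1 - z) ^+ r.-1.
  exact: (cvg_comp _ _ ql0 (@exprn_continuous R r.-1 (1 - z))).
by apply: (cvgr_to_le ql); apply: nearW => n; have := yP n; rewrite lee_fin.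
Qed.

(** For any one-element [J]: the full index set when [m = 1], and a singleton giving a lower bound
    when [m > 1]. *)
Lemma single_selection_limit : exists L : {RV P >-> R},
  almost_everywhere P (fun w => desc_prop R r \o H^~ w @ \oo --> L w) /\
  forall x, P [set w | x < L w] = (min_tail r.-1 x)%:E.
Proof.
(* The upper limit is defined and measurable everywhere, and equals the limit wherever that
   exists. *)
pose L w := limn_sup (fun n => desc_prop R r (H n w)).
have mL : measurable_fun setT L.
  apply: measurable_realfun.measurable_fun_limn_sup.
  - by move=> w _; exists 1 => _ [n _ <-]; exact: prop_le1.
  - by move=> w _; exists 0 => _ [n _ <-]; exact: prop_ge0.
  - exact: measurable_desc_prop.
have pL : almost_everywhere P (fun w => desc_prop R r \o H^~ w @ \oo --> L w).
  have K0 : (0 < #|J|)%N by rewrite J1.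
  apply: (ae_sub (prop_cvg_ae hS r_gt1 K0)) => w pw.
  by rewrite /L (cvg_limn_supE pw); exact: pw.
pose L' : {RV P >-> R} := HB.pack_for {mfun _ >-> R} L
  (@isMeasurableFun.Build _ _ _ _ L mL).
by exists L'; split => //; exact: limit_tail.
Qed.

End single_selection_limit.

(** * Transfer to [desc_ratio] and the two cases of [m] *)

Theorem theorem2p4 (R : realType) (d : measure_display) (T : measurableType d)
    (P : probability T R) (m : nat) (S : nat -> 'I_m -> {RV P >-> nat})
    (r : nat) (hm : (0 < m)%N) (hr : (1 < r)%N) (hS : uniform_attachment S) :
  let p (t : nat) (w : T) : R := desc_ratio R (fun x j => S x j w) r t in
  (m = 1%N ->
    (exists L : {RV P >-> R},
      {ae P, forall w, p t w @[t --> \oo] --> L w} /\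
      (forall (d' : measure_display) (T' : measurableType d')
         (Q : probability T' R) (U : 'I_r.-1 -> {RV Q >-> R}),
         iid_uniform01 U ->
         forall B : set R, measurable B ->
           distribution P L B =
           Q (family_min (fun i w => U i w) @^-1` B))) /\
    {ae P, forall w, (0 < limn_einf (fun t => (p t w)%:E))%E}) /\
  ((1 < m)%N -> {ae P, forall w, p t w @[t --> \oo] --> (1 : R)}).
Proof.
move=> p; pose JT : {set 'I_m} := [set: 'I_m]%SET; have r0 : (0 < r)%N by exact: ltnW.
(* Histories start at time [r], hence the shift of the index by [r]. *)
have p_cvg w (l : R) : (forall y j, (1 < y)%N -> (0 < S y j w < y)%N) ->
    desc_prop R r \o (rhist S r JT)^~ w @ \oo --> l ->
    p t w @[t --> \oo] --> l.
  move=> Sw pl; rewrite -(cvg_shiftn r) /=.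
  rewrite (_ : (fun n => _) = desc_prop R r \o (rhist S r JT)^~ w)//.
  apply/funext => n /=; rewrite /p /desc_ratio addnC num_descendantsE//.
  by rewrite /desc_prop size_hist.
(* The tail at 0 equals 1. *)
have posP (L : {RV P >-> R}) :
    (forall x, P [set w | x < L w] = (min_tail r.-1 x)%:E) ->
    almost_everywhere P (fun w => 0 < L w).
  move=> tL; have mL : measurable [set w | 0 < L w].
    by apply: measurable_gt; exact: measurable_funPT.
  apply/negligibleP; first exact: measurableC.
  rewrite [LHS]probability_setC// tL /min_tail (max_idPr _)// (min_idPr ler01).
  by rewrite subr0 expr1n subee.
split=> [m1|m1].
  have J1 : #|JT| = 1%N by rewrite cardsT card_ord.
  have [L [pL tL]] := single_selection_limit hS hr J1.
  have pL' : almost_everywhere P (fun w => p t w @[t --> \oo] --> L w).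
    by apply: (ae_sub (ae_and (selections_below_ae hS) pL)) => w [Sw]; exact: p_cvg.
  split.
    exists L; split=> // d' T' Q U iidU B mB.
    pose M := family_min (fun i w => U i w).
    have mM : measurable_fun setT M.
      by apply: measurable_family_min => i; exact: measurable_funPT.
    pose M' : {RV Q >-> R} := HB.pack_for {mfun _ >-> R} M
      (@isMeasurableFun.Build _ _ _ _ M mM).
    rewrite -[RHS]/(distribution Q M' B).
    apply: measureR_unique => //.
      move=> x; rewrite -[RHS]/(Q (M @^-1` `]x, +oo[%classic)).
      rewrite (family_min_tail _ _ iidU); last by lia.
      rewrite -tL -[LHS]/(P (L @^-1` `]x, +oo[%classic)); congr (P _).
      by apply/seteqP; split => w /=; rewrite in_itv/= andbT.
    by move=> x; rewrite (le_lt_trans (probability_le1 _ _))// ltry.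
  apply: (ae_sub (ae_and pL' (posP L tL))) => w [pLw L0].
  have pE : (p t w)%:E @[t --> \oo] --> (L w)%:E.
    by apply: cvg_EFin; [exact: nearW|exact: pLw].
  by have [-> _] := cvg_limn_einf_sup pE; rewrite lte_fin.
(* [Ordinal hm] is the index 0: the coupled process keeps only the first selection. *)
have [L [pL tL]] := single_selection_limit hS hr (cards1 (Ordinal hm)).
have K0 : (0 < #|JT|)%N by rewrite cardsT card_ord.
have K1 : (1 < #|JT|)%N by rewrite cardsT card_ord.
apply: (ae_sub (ae_and (ae_and (selections_below_ae hS) (mart_cvg_ae hS JT hr))
  (ae_and pL (posP L tL)))) => w [[Sw mc] [pLw L0]].
apply: p_cvg => //.
have HS n : rhist S r JT n.+1 w = hit JT (fun j => S (r + n).+1 j w)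
    (desc_list r (rhist S r JT n w)) :: rhist S r JT n w by [].
have /cvg_ex[l pl] := prop_cvg r0 HS K0 mc.
suff l1 : l = 1 by rewrite l1 in pl.
apply: (prop_lim_eq1 r0 _ HS K0 K1 mc pl) => //.
(* The limit with one selection is positive and, by the coupling, at most [l]. *)
apply: lt_le_trans L0 _.
apply: (ler_cvg_to pLw pl); apply: nearW => n /=.
rewrite /desc_prop !size_hist ler_pM2r ?invr_gt0 ?ltr0n ?addn_gt0 ?r0// ler_nat.
by apply: ndesc_hist_le; exact: finset.subsetT.
Qed.
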